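(* Let $\mathcal{L}\subseteq\mathbb{Z}^3$ be an order ideal with $\mathcal{L}\subseteq C(0,0,0)$ and $\mathcal{U}\cap C(0,0,0)$ finite, let $\mathcal{I}$ be as in the context, let $N$ be a cutoff for $\mathcal{I}$, and let $G$ be an $\mathcal{I}$-grove within radius $N$. Suppose $G$ contains $n_a$ long edges of the form $e_a(i,j,k)$, $n_b$ of the form $e_b(i,j,k)$, and $n_c$ of the form $e_c(i,j,k)$. Then $n_a+n_b-n_c$, $n_b+n_c-n_a$, and $n_c+n_a-n_b$ are all nonnegative and even.
   Context: For $(i,j,k)\in\mathbb{Z}^3$ let $C(i,j,k)=\{(i',j',k') : i'\le i,\ j'\le j,\ k'\le k\}$. $\mathcal{L}\subseteq\mathbb{Z}^3$ satisfies: $(i,j,k)\in\mathcal{L}\Rightarrow C(i,j,k)\subseteq\mathcal{L}$. $\mathcal{U}=\mathbb{Z}^3\setminus\mathcal{L}$, $\mathcal{I}=\{(i,j,k)\in\mathcal{L} : (i+1,j+1,k+1)\in\mathcal{U}\}$. A cutoff for $\mathcal{I}$ is an integer $N$ such that (i) $(i,j,k)\in\mathcal{I}$ whenever $i+j+k\le -N$ and $\max\{i,j,k\}=0$; (ii) $(i,j,k)\notin\mathcal{I}$ whenever $i+j+k\le -N-3$ and $\max\{i,j,k\}<0$. For $(i,j,k)\in\mathcal{I}$ let $r_a(i,j,k)=\{(i,j,k),(i,j-1,k),(i,j,k-1),(i,j-1,k-1)\}$, $r_b(i,j,k)=\{(i,j,k),(i-1,j,k),(i,j,k-1),(i-1,j,k-1)\}$,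 $r_c(i,j,k)=\{(i,j,k),(i-1,j,k),(i,j-1,k),(i-1,j-1,k)\}$; a rhombus is such a set contained in $\mathcal{I}$. Long edges: $e_a(i,j,k)=\{(i,j-1,k),(i,j,k-1)\}$, $e_b(i,j,k)=\{(i-1,j,k),(i,j,k-1)\}$, $e_c(i,j,k)=\{(i-1,j,k),(i,j-1,k)\}$; short edges: $e'_a(i,j,k)=\{(i,j,k),(i,j-1,k-1)\}$, $e'_b(i,j,k)=\{(i,j,k),(i-1,j,k-1)\}$, $e'_c(i,j,k)=\{(i,j,k),(i-1,j-1,k)\}$ (for $r_a,r_b,r_c$ respectively). A long edge ''of the form $e_a(i,j,k)$'' means the long edge of a rhombus $r_a(i,j,k)$, etc. $\mathcal{G}$ is the graph on $\mathcal{I}$ whose edges are the long and short edges of all rhombi. An $\mathcal{I}$-grove within radius $N$ is a subgraph $G\subseteq\mathcal{G}$ with: vertex set all of $\mathcal{I}$; for every rhombus exactly one of its two edges in $G$; for every rhombus all of whose vertices satisfy $i+j+k<-N$, its short edge in $G$; and every component of $G$ contains exactly one of the following sets, each of which lies in some component: $\{(0,p,q),(p,0,q)\}$, $\{(p,q,0),(0,q,p)\}$, $\{(q,0,p),(q,p,0)\}$ for $0>p>q$, $p+q\in\{-N-1,-N-2\}$; $\{(0,p,p),(p,0,p),(p,p,0)\}$ for $2p\in\{-N-1,-N-2\}$; $\{(0,0,q)\},\{(0,q,0)\},\{(q,0,0)\}$ for $q\le -N-1$. *)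

(* Defs.v *)
From mathcomp Require Import all_boot all_order all_algebra.
From mathcomp Require Import all_classical.
From Stdlib Require Export Relation_Operators.

Set Implicit Arguments.
Unset Strict Implicit.
Unset Printing Implicit Defensive.

Import Order.TTheory GRing.Theory Num.Theory.
Local Open Scope classical_set_scope.
Local Open Scope ring_scope.

(* An edge is an unordered pair, represented by the set of its endpoints. *)
Record graph (T : Type) := Graph {
  vertices : set T;
  edges : set (set T)
}.

Definition subgraph (T : Type) (G H : graph T) : Prop :=
  [/\ vertices G `<=` vertices H, edges G `<=` edges H &
      forall e, edges G e -> e `<=` vertices G].

Definition adjacent (T : Type) (G : graph T) (u v : T) : Prop :=
  edges G [set u; v].

Definition component_of (T : Type) (G : graph T) (v : T) : set T :=
  [set w | vertices G w /\ clos_refl_trans T (adjacent G) v w].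

Definition components (T : Type) (G : graph T) : set (set T) :=
  [set component_of G v | v in vertices G].

Definition Z3 : Type := (int * int * int)%type.

Definition C (i j k : int) : set Z3 :=
  [set v : Z3 | [/\ v.1.1 <= i, v.1.2 <= j & v.2 <= k]].

Definition order_ideal (L : set Z3) : Prop :=
  forall i j k : int, L (i, j, k) -> C i j k `<=` L.

Definition upper (L : set Z3) : set Z3 := ~` L.

Definition initial (L : set Z3) : set Z3 :=
  [set v : Z3 | L v /\ upper L (v.1.1 + 1, v.1.2 + 1, v.2 + 1)].

Definition cutoff (I : set Z3) (N : int) : Prop :=
  (forall i j k : int, i + j + k <= - N ->
     Num.max i (Num.max j k) = 0 -> I (i, j, k)) /\
  (forall i j k : int, i + j + k <= - N - 3 ->
     Num.max i (Num.max j k) < 0 -> ~ I (i, j, k)).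

Inductive orientation := Oa | Ob | Oc.

Definition rhombus (o : orientation) (i j k : int) : set Z3 :=
  match o with
  | Oa => [set (i, j, k); (i, j - 1, k); (i, j, k - 1); (i, j - 1, k - 1)]
  | Ob => [set (i, j, k); (i - 1, j, k); (i, j, k - 1); (i - 1, j, k - 1)]
  | Oc => [set (i, j, k); (i - 1, j, k); (i, j - 1, k); (i - 1, j - 1, k)]
  end.

Definition long_edge (o : orientation) (i j k : int) : set Z3 :=
  match o with
  | Oa => [set (i, j - 1, k); (i, j, k - 1)]
  | Ob => [set (i - 1, j, k); (i, j, k - 1)]
  | Oc => [set (i - 1, j, k); (i, j - 1, k)]
  end.

Definition short_edge (o : orientation) (i j k : int) : set Z3 :=
  match o with
  | Oa => [set (i, j, k); (i, j - 1, k - 1)]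
  | Ob => [set (i, j, k); (i - 1, j, k - 1)]
  | Oc => [set (i, j, k); (i - 1, j - 1, k)]
  end.

Definition rhombus_in (I : set Z3) (o : orientation) (i j k : int) : Prop :=
  rhombus o i j k `<=` I.

Definition rhombus_graph (I : set Z3) : graph Z3 :=
  Graph I [set e : set Z3 | exists o i j k, rhombus_in I o i j k /\
                              (e = long_edge o i j k \/ e = short_edge o i j k)].

(* The groups of boundary vertices that a grove must separate from one another,
   each group being connected. *)
Definition boundary_sets (N : int) : set (set Z3) :=
  [set S : set Z3 |
     [\/ exists p q : int,
           [/\ q < p, p < 0, p + q = - N - 1 \/ p + q = - N - 2 &
               [\/ S = [set (0, p, q); (p, 0, q)],
                   S = [set (p, q, 0); (0, q, p)] |
                   S = [set (q, 0, p); (q, p, 0)] ] ],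
         exists p : int,
           (2 * p = - N - 1 \/ 2 * p = - N - 2) /\
           S = [set (0, p, p); (p, 0, p); (p, p, 0)] |
         exists q : int,
           q <= - N - 1 /\
           [\/ S = [set (0, 0, q)],
               S = [set (0, q, 0)] |
               S = [set (q, 0, 0)] ] ] ].

Record grove (I : set Z3) (N : int) (G : graph Z3) : Prop := {
  grove_subgraph : subgraph G (rhombus_graph I);
  grove_vertices : vertices G = I;
  grove_rhombus : forall o i j k, rhombus_in I o i j k ->
    exists! e, [set long_edge o i j k; short_edge o i j k] e /\ edges G e;
  grove_far : forall o i j k, rhombus_in I o i j k ->
    (forall v, rhombus o i j k v -> v.1.1 + v.1.2 + v.2 < - N) ->
    edges G (short_edge o i j k);
  grove_component : forall K, components G K ->
    exists! S, boundary_sets N S /\ S `<=` K;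
  grove_boundary : forall S, boundary_sets N S ->
    exists2 K, components G K & S `<=` K
}.

Definition long_edges (I : set Z3) (G : graph Z3) (o : orientation) :
    set (set Z3) :=
  [set e | edges G e /\
           exists i j k, rhombus_in I o i j k /\ e = long_edge o i j k].

(* Main.v *)
Require Import Defs.
From mathcomp Require Import all_boot all_order all_algebra.
From mathcomp Require Import all_classical.
From mathcomp Require Import zify.

Set Implicit Arguments.
Unset Strict Implicit.
Unset Printing Implicit Defensive.

Import Order.TTheory GRing.Theory Num.Theory.
Local Open Scope classical_set_scope.
Local Open Scope card_scope.
Local Open Scope ring_scope.

(** Induction on the finite set U ∩ C(0,0,0).  Moving a lowest point c of it to
    L replaces the three lower faces of a cube by the three upper ones; on the
    edges of G this is a star-triangle move, under which the triple of long-edge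
    counts changes by 0 or by plus or minus a sum of two distinct unit vectors.
    This keeps the parity.  When there is a choice (no lower face is long), it can be
    made so that a prescribed one of the three quantities does not increase; in
    the other cases none of them increases.  When L = C(0,0,0), no edge is long:
    short diagonals lead downwards from the two ends of a long edge to boundary
    vertices that a grove must separate. *)

(** * Coordinates, tiles, colorings and the structure kept by the induction *)

Definition coord (o : orientation) (v : Z3) : int :=
  match o with Oa => v.1.1 | Ob => v.1.2 | Oc => v.2 end.

Definition down (o : orientation) (v : Z3) : Z3 :=
  match o with
  | Oa => (v.1.1 - 1, v.1.2, v.2)
  | Ob => (v.1.1, v.1.2 - 1, v.2)
  | Oc => (v.1.1, v.1.2, v.2 - 1)
  end.

Definition up (o : orientation) (v : Z3) : Z3 :=
  match o with
  | Oa => (v.1.1 + 1, v.1.2, v.2)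
  | Ob => (v.1.1, v.1.2 + 1, v.2)
  | Oc => (v.1.1, v.1.2, v.2 + 1)
  end.

Definition other1 (o : orientation) := if o is Oa then Ob else Oa.
Definition other2 (o : orientation) := if o is Oc then Ob else Oc.

Definition down3 (v : Z3) : Z3 := down Oa (down Ob (down Oc v)).
Definition up3 (v : Z3) : Z3 := up Oa (up Ob (up Oc v)).

Definition height (v : Z3) : int := v.1.1 + v.1.2 + v.2.

Definition nonpos (v : Z3) : bool := [&& v.1.1 <= 0, v.1.2 <= 0 & v.2 <= 0].

(** For an order ideal this is containment of the rhombus with top vertex [v] in [initial L] (see
    [rhombus_inE]): the vertex opposite to [v] has [up o v] as its [up3], so the two conditions
    bound the whole rhombus. *)
Definition tile (L : pred Z3) (o : orientation) (v : Z3) : bool :=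
  L v && ~~ L (up o v).

Definition end1 (long : bool) (o : orientation) (v : Z3) : Z3 :=
  if long then down (other1 o) v else v.
Definition end2 (long : bool) (o : orientation) (v : Z3) : Z3 :=
  if long then down (other2 o) v else down (other1 o) (down (other2 o) v).

Definition invariant (L : pred Z3) (long : orientation -> pred Z3)
    (P : pred Z3) : Prop :=
  forall o v, tile L o v -> P (end1 (long o v) o v) = P (end2 (long o v) o v).

Definition boundary (N : int) (v : Z3) : Prop :=
  exists2 S, boundary_sets N S & S v.

(* What the induction on the upper set retains of a grove.  A connected
   component is replaced by the boolean functions that are constant along all
   edges. *)
Record pregrove (N : int) (L : pred Z3) (long : orientation -> pred Z3) :
    Prop := Pregrove {
  pg_nonpos : forall v, L v -> nonpos v;
  pg_down : forall o v, L v -> L (down o v);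
  pg_cutoff : forall v, L v -> ~~ L (up3 v) -> nonpos (up3 v) ->
    - N - 3 < height v;
  pg_far : forall o v, tile L o v -> height v < - N -> ~~ long o v;
  pg_reach : forall P v, invariant L long P -> L v -> ~~ L (up3 v) -> P v ->
    exists2 b, boundary N b & P b;
  pg_separate : forall b b', boundary N b -> boundary N b' ->
    (forall S, boundary_sets N S -> S b -> S b' -> False) ->
    exists P, [/\ invariant L long P, P b & ~~ P b']
}.

Lemma downK o : cancel (up o) (down o).
Proof. by case: o => -[[i j] k]; rewrite /= ?addrK. Qed.

Lemma upK o : cancel (down o) (up o).
Proof. by case: o => -[[i j] k]; rewrite /= ?subrK. Qed.

Lemma downC o o' v : down o (down o' v) = down o' (down o v).
Proof. by case: o; case: o'. Qed.

Lemma down3K v : up3 (down3 v) = v.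
Proof. by case: v => -[i j] k; rewrite /down3 /up3 /= !subrK. Qed.

Lemma height_down o v : height (down o v) = height v - 1.
Proof. by case: o; case: v => -[i j] k; rewrite /height /=; lia. Qed.

(** * Boundary vertices and the base case L = C(0,0,0) *)

Lemma boundary_coord0 N b : boundary N b -> exists o, coord o b = 0.
Proof.
case=> S [[p [q [_ _ _ [] ->]]]|[p [_ ->]]|[q [_ [] ->]]] /=.
- by case=> ->; [exists Oa|exists Ob].
- by case=> ->; [exists Oc|exists Oa].
- by case=> ->; [exists Ob|exists Oc].
- by case=> [[]|] ->; [exists Oa|exists Ob|exists Oc].
- by move=> ->; exists Oa.
- by move=> ->; exists Oa.
- by move=> ->; exists Ob.
Qed.

Lemma boundary_height N b : boundary N b -> height b <= - N - 1.
Proof.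
case=> S [[p [q [_ _ h [] ->]]]|[p [h ->]]|[q [h [] ->]]] /=; rewrite /height.
- by case: h => h; case=> -> /=; lia.
- by case: h => h; case=> -> /=; lia.
- by case: h => h; case=> -> /=; lia.
- by case: h => h; case=> [[]|] -> /=; lia.
- by move=> -> /=; lia.
- by move=> -> /=; lia.
- by move=> -> /=; lia.
Qed.

(** If a second coordinate vanishes, the vertex forms a singleton boundary set; otherwise the order
    of the two nonzero coordinates selects the pair or triple containing it. *)
Lemma boundaryI N o v : nonpos v -> coord o v = 0 ->
  height v = - N - 1 \/ height v = - N - 2 -> boundary N v.
Proof.
case: v => -[i j] k /and3P[/= i0 j0 k0]; rewrite /height /= => o0 h.
have zz (S : set Z3) q : q <= - N - 1 ->
    [\/ S = [set (0, 0, q)], S = [set (0, q, 0)] | S = [set (q, 0, 0)]] ->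
    boundary_sets N S.
  by move=> hq hS; constructor 3; exists q.
have pq (S : set Z3) p q : q < p -> p < 0 -> p + q = - N - 1 \/ p + q = - N - 2 ->
    [\/ S = [set (0, p, q); (p, 0, q)],
        S = [set (p, q, 0); (0, q, p)] | S = [set (q, 0, p); (q, p, 0)]] ->
    boundary_sets N S.
  by move=> *; constructor 1; exists p, q.
have pp (S : set Z3) p : 2 * p = - N - 1 \/ 2 * p = - N - 2 ->
    S = [set (0, p, p); (p, 0, p); (p, p, 0)] -> boundary_sets N S.
  by move=> *; constructor 2; exists p.
case: o o0 => /= o0; subst.
- have [j1|j1] := eqVneq j 0; first subst.
    by exists [set (0, 0, k)] => //; apply: (zz _ k); [lia|constructor 1].
  have [k1|k1] := eqVneq k 0; first subst.
    by exists [set (0, j, 0)] => //; apply: (zz _ j); [lia|constructor 2].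
  have [jk|kj|jk] := ltgtP j k; last subst.
  + exists [set (k, j, 0); (0, j, k)]; last by right.
    by apply: (pq _ k j); [lia|lia|lia|constructor 2].
  + exists [set (0, j, k); (j, 0, k)]; last by left.
    by apply: (pq _ j k); [lia|lia|lia|constructor 1].
  + exists [set (0, k, k); (k, 0, k); (k, k, 0)]; last by left; left.
    by apply: (pp _ k); [lia|].
- have [i1|i1] := eqVneq i 0; first subst.
    by exists [set (0, 0, k)] => //; apply: (zz _ k); [lia|constructor 1].
  have [k1|k1] := eqVneq k 0; first subst.
    by exists [set (i, 0, 0)] => //; apply: (zz _ i); [lia|constructor 3].
  have [ik|ki|ik] := ltgtP i k; last subst.
  + exists [set (i, 0, k); (i, k, 0)]; last by left.
    by apply: (pq _ k i); [lia|lia|lia|constructor 3].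
  + exists [set (0, i, k); (i, 0, k)]; last by right.
    by apply: (pq _ i k); [lia|lia|lia|constructor 1].
  + exists [set (0, k, k); (k, 0, k); (k, k, 0)]; last by left; right.
    by apply: (pp _ k); [lia|].
- have [i1|i1] := eqVneq i 0; first subst.
    by exists [set (0, j, 0)] => //; apply: (zz _ j); [lia|constructor 2].
  have [j1|j1] := eqVneq j 0; first subst.
    by exists [set (i, 0, 0)] => //; apply: (zz _ i); [lia|constructor 3].
  have [ij|ji|ij] := ltgtP i j; last subst.
  + exists [set (i, 0, j); (i, j, 0)]; last by right.
    by apply: (pq _ j i); [lia|lia|lia|constructor 3].
  + exists [set (i, j, 0); (0, j, i)]; last by left.
    by apply: (pq _ i j); [lia|lia|lia|constructor 2].
  + exists [set (0, j, j); (j, 0, j); (j, j, 0)]; last by right.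
    by apply: (pp _ j); [lia|].
Qed.

(** The vertices of one pair or triple have their only zero in different positions. *)
Lemma boundary_sets_coord0_inj N S o u v : boundary_sets N S -> S u -> S v ->
  coord o u = 0 -> coord o v = 0 -> u = v.
Proof.
case: u v => -[i j] k [[i' j'] k'].
case=> [[p [q [hqp hp _ [] ->]]]|[p [_ ->]]|[q [_ [] ->]]] /=.
- by case=> -[-> -> ->]; case=> -[-> -> ->]; case: o => //=; lia.
- by case=> -[-> -> ->]; case=> -[-> -> ->]; case: o => //=; lia.
- by case=> -[-> -> ->]; case=> -[-> -> ->]; case: o => //=; lia.
- by case=> [[]|] [-> -> ->]; case=> [[]|] [-> -> ->] //=; case: o => //=; congruence.
- by move=> -> ->.
- by move=> -> ->.
- by move=> -> ->.
Qed.

(* Following the short diagonals downwards from the two ends of a long edge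
   leads to boundary vertices in different boundary sets. *)
Lemma base_no_long N (L : pred Z3) long o v : pregrove N L long ->
  (forall v, L v = nonpos v) -> tile L o v -> ~~ long o v.
Proof.
move=> pg LE.
pose diag o v := down (other1 o) (down (other2 o) v).
have tileE o' w : tile L o' w = nonpos w && (coord o' w == 0).
  by rewrite /tile !LE /nonpos; case: o' => /=; lia.
have tile_diag o' w : tile L o' w -> tile L o' (diag o' w).
  by rewrite !tileE /nonpos; case: o' => /=; lia.
have tile_iter o' w t : tile L o' w -> tile L o' (iter t (diag o') w).
  by move=> tw; elim: t => //= t; apply: tile_diag.
have height_iter o' w t : height (iter t (diag o') w) = height w - (2 * t)%N%:Z.
  by elim: t => [|t IH]; rewrite /= ?subr0 // !height_down IH; lia.
have diag_inj o' : injective (diag o').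
  by move=> a b; rewrite /diag => /(can_inj (@upK _))/(can_inj (@upK _)).
have iter_inj o' t : injective (iter t (diag o')).
  by elim: t => [|t IH] a b //= /diag_inj/IH.
(* Induction on the height above -N; below that level [pg_far] already excludes long edges. *)
have [m] := ubnP (absz (height v + N)); elim: m o v => // m IH o v vm tv.
have [hv|hv] := ltP (height v) (- N); first exact: (pg_far pg).
apply/negP => lv.
(* Each diagonal lowers the height by 2, so [t] of them lead from height [height v - 1] to -N-1 or
   -N-2, according to parity; these are the heights accepted by [boundaryI]. *)
pose t := ((absz (height v + N)).+1)./2.
(* The tiles met on the way down are lower than [v], hence short by induction or by [pg_far], and
   their short edges carry the color along. *)
have descend P s w : invariant L long P -> tile L o w ->
    height w = height v - 1 -> (s <= t)%N -> P w = P (iter s (diag o) w).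
  move=> iP tw hw; elim: s => // s IHs st; rewrite IHs ?(ltnW st) //=.
  have := iP _ _ (tile_iter _ _ s tw).
  suff /negbTE -> : ~~ long o (iter s (diag o) w) by [].
  have [hlo|hlo] := ltP (height (iter s (diag o) w)) (- N).
    by apply: (pg_far pg) => //; apply: tile_iter.
  by apply: IH; [move: hlo; rewrite height_iter; lia|apply: tile_iter].
set u := down (other1 o) v; set w := down (other2 o) v.
have tu : tile L o u by move: tv; rewrite !tileE /nonpos /u; case: (o) => /=; lia.
have tw : tile L o w by move: tv; rewrite !tileE /nonpos /w; case: (o) => /=; lia.
have neq_uw : u <> w.
  move=> /(congr1 (coord (other1 o))); rewrite /u /w.
  by case: (o) => /=; lia.
have hu : height u = height v - 1 by rewrite height_down.
have hw : height w = height v - 1 by rewrite height_down.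
have bd z : tile L o z -> height z = height v - 1 ->
    coord o (iter t (diag o) z) = 0 /\ boundary N (iter t (diag o) z).
  move=> tz hz; have := tile_iter _ _ t tz; rewrite tileE => /andP[np /eqP c0].
  split=> //; apply: boundaryI np c0 _; rewrite height_iter hz /t; lia.
have [cu bu] := bd _ tu hu; have [cw bw] := bd _ tw hw.
(* A common boundary set would force the two end points, hence [u] and [w], to coincide. Otherwise a
   separating coloring contradicts the long edge joining [u] and [w]. *)
case: (pg_separate pg bu bw) => [S bS Su Sw|P [iP]].
  by apply/neq_uw/iter_inj/(boundary_sets_coord0_inj bS Su Sw cu cw).
rewrite -!descend //; have := iP _ _ tv; rewrite lv /= -/u -/w => ->.
by move=> ->.
Qed.

(** * The star-triangle move on the edges of a cube *)

Definition flip (L : pred Z3) (c : Z3) : pred Z3 := fun v => (v == c) || L v.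

Definition same (o o' : orientation) : bool :=
  match o, o' with Oa, Oa | Ob, Ob | Oc, Oc => true | _, _ => false end.

(* [l] records which of the three lower faces of a cube use their long edge,
   the result which of the upper faces do.  The lower short edges form a star
   and the upper long edges a triangle on the same three vertices, and
   conversely.  A full star may be replaced by any two sides of the triangle;
   the face left short is then chosen different from [x]. *)
Definition star_triangle (x : orientation) (l : orientation -> bool)
    (o : orientation) : bool :=
  match (l Oa + l Ob + l Oc)%N with
  | 0%N => ~~ same o (other1 x)
  | 1%N => l o
  | _ => false
  end.

Definition flip_long (x : orientation) (c : Z3) (long : orientation -> pred Z3)
    (o : orientation) : pred Z3 :=
  fun v => if v == c then star_triangle x (fun o => long o (down o c)) o
           else long o v.

Definition recolor (P : pred Z3) (z : Z3) (b : bool) : pred Z3 :=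
  fun v => if v == z then b else P v.

(** [A] and [B] are the colors of the six cube vertices other than the top and the bottom, [D] that
    of the bottom and [E] that of the top. A coloring of the six extends to the bottom along the
    lower edges exactly when it extends to the top along the upper ones, since both edge sets
    connect the six in the same way. *)
Lemma star_triangleP x l (A B : orientation -> bool) :
  ~~ [&& l Oa, l Ob & l Oc] ->
  (exists D, forall o, if l o then B (other2 o) = B (other1 o) else A o = D) <->
  (exists E, forall o, if star_triangle x l o then A (other1 o) = A (other2 o)
                       else E = B o).
Proof.
rewrite /star_triangle => nl; split=> [[D h]|[E h]].
(* Any short upper face forces [E]. The final default is correct because some upper face is short;
   the choice of [D] below similarly relies on a short lower face. *)
- exists (if ~~ star_triangle x l Oa then B Oa
          else if ~~ star_triangle x l Ob then B Ob else B Oc).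
  move: (h Oa) (h Ob) (h Oc) nl => {h}; rewrite /star_triangle.
  case la: (l Oa); case lb: (l Ob); case lc: (l Oc) => //=;
  by case: x => //= h1 h2 h3 _; case=> /=; rewrite ?la ?lb ?lc /=; congruence.
- exists (if ~~ l Oa then A Oa else if ~~ l Ob then A Ob else A Oc).
  move: (h Oa) (h Ob) (h Oc) nl => {h}.
  case la: (l Oa); case lb: (l Ob); case lc: (l Oc) => //=;
  by case: x => //= h1 h2 h3 _; case=> /=; rewrite ?la ?lb ?lc /=; congruence.
Qed.

Lemma star_triangle_short x l : exists o, ~~ star_triangle x l o.
Proof.
rewrite /star_triangle.
case la: (l Oa); case lb: (l Ob); case lc: (l Oc) => /=; try by exists Oa.
- by exists Ob; rewrite lb.
- by exists Oa; rewrite la.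
- by exists Oa; rewrite la.
- by exists (other1 x); case: x.
Qed.

(** The inequality, written without subtraction, says that the count for [other1 x] plus that for
    [other2 x] minus that for [x] does not increase. For a full star the face of [other1 x] stays
    short, so the new long edges at [x] and [other2 x] cancel. *)
Lemma star_triangle_count x l :
  ~~ [&& l Oa, l Ob & l Oc] ->
  let l' := star_triangle x l in
  (l x + l' (other1 x) + l' (other2 x) <=
     l' x + l (other1 x) + l (other2 x))%N /\
  odd (l x + l (other1 x) + l (other2 x)) =
  odd (l' x + l' (other1 x) + l' (other2 x)).
Proof.
rewrite /star_triangle; case la: (l Oa); case lb: (l Ob); case lc: (l Oc) => //=;
  by case: x => //= _; rewrite /= ?la ?lb ?lc.
Qed.

(** * Pregroves survive adding a lowest point to L *)

Lemma eq_down o u v : (up o u == v) = (u == down o v).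
Proof. by rewrite (can2_eq (@downK o) (@upK o)). Qed.

Lemma height_down3 v : height (down3 v) = height v - 3.
Proof. by rewrite /down3 !height_down; lia. Qed.

Section Flip.

Variables (N : int) (L : pred Z3) (long : orientation -> pred Z3) (c : Z3).
Hypotheses (pg : pregrove N L long) (cL : ~~ L c) (c_nonpos : nonpos c).
Hypothesis (down_c : forall o, L (down o c)).
Variable x : orientation.

Let d := down3 c.
Let l o := long o (down o c).

Let Ld : L d. Proof. exact: (pg_down pg Oa (pg_down pg Ob (down_c Oc))). Qed.

Let Lup o v : L (up o v) -> L v.
Proof. by move/(pg_down pg o); rewrite downK. Qed.

Let L_neq_c v : L v -> v != c.
Proof. by move=> Lv; apply/eqP => e; move: cL; rewrite -e Lv. Qed.

Lemma tile_flip o v :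
  tile (flip L c) o v = (v == c) || tile L o v && (v != down o c).
Proof.
rewrite /tile /flip negb_or eq_down; have [->|vc] /= := eqVneq v c.
  rewrite eq_sym L_neq_c //=. exact: (contra (@Lup o c) cL).
by rewrite andbA andbAC.
Qed.

Lemma tile_down_c o : tile L o (down o c).
Proof. by rewrite /tile down_c upK cL. Qed.

Let ends_L b o v : L v -> L (end1 b o v) /\ L (end2 b o v).
Proof. by move=> Lv; rewrite /end1 /end2; case: b; split; do 2?[apply: (pg_down pg)]. Qed.

(** Only the lower faces of the cube have an edge ending at its bottom [d]: in every other position
    of [v] the point [up o v] would lie at or below some [down o' c], hence in [L]. *)
Let ends_neq_d b o v : tile L o v -> v != down o c ->
  end1 b o v != d /\ end2 b o v != d.
Proof.
move=> /andP[Lv nLv] vc.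
have ne (w : Z3) : L w -> up o v <> w by move=> Lw e; rewrite e Lw in nLv.
have Ldd o1 o2 : L (down o1 (down o2 c)) by rewrite (pg_down pg).
rewrite /d /end1 /end2; case: b; split; apply/eqP => e.
- have {}e : v = up (other1 o) d by rewrite /d -e upK.
  apply: (ne _ (down_c (other2 o))); rewrite e /d.
  by case: (o); rewrite /down3 /= ?subrK.
- have {}e : v = up (other2 o) d by rewrite /d -e upK.
  apply: (ne _ (down_c (other1 o))); rewrite e /d.
  by case: (o); rewrite /down3 /= ?subrK.
- apply: (ne _ (Ldd (other1 o) (other2 o))); rewrite e /d.
  by case: (o); rewrite /down3 /= ?subrK.
- move: vc; rewrite -(upK (other1 o) (down o c)) -(upK (other2 o) (down (other1 o) _)).
  have -> : down (other2 o) (down (other1 o) (down o c)) = d by case: (o).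
  by rewrite /d -e downC !upK eqxx.
Qed.

(** Three long lower faces would isolate [d], making its indicator invariant. But [d] has negative
    coordinates, so it is not a boundary vertex, against [pg_reach]. *)
Lemma long_lower_faces : ~~ [&& l Oa, l Ob & l Oc].
Proof.
apply/negP => /and3P[la lb lc].
have inv : invariant L long (pred1 d).
  move=> o v tv; have [->|vc] := eqVneq v (down o c).
    have -> : long o (down o c) by case: (o).
    have neq o1 o2 : down o1 (down o2 c) == d = false.
      apply/eqP => /(congr1 height).
      by rewrite height_down3 !height_down; lia.
    by rewrite /= !neq.
  have [/negbTE e1 /negbTE e2] := ends_neq_d (long o v) tv vc.
  by rewrite /= e1 e2.
have [|||b bN /eqP bd] := pg_reach pg inv (v := d); rewrite /= ?down3K //.
by have [o] := boundary_coord0 bN; rewrite bd /d; move: c_nonpos;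
  rewrite /nonpos; case: o => /=; lia.
Qed.

Let boundary_neq_d b : boundary N b -> b != d.
Proof.
move=> bN; apply/eqP => bd.
by have [o] := boundary_coord0 bN; rewrite bd /d; move: c_nonpos;
  rewrite /nonpos; case: o => /=; lia.
Qed.

(** The cutoff condition at [d] keeps all flips above height -N. Hence [c] is not a boundary vertex
    and the new faces at [c] escape the condition on far rhombi. *)
Let height_c : - N < height c.
Proof.
have := pg_cutoff pg Ld; rewrite /d down3K height_down3 => /(_ cL c_nonpos); lia.
Qed.

Let boundary_neq_c b : boundary N b -> b != c.
Proof.
move=> bN; apply/eqP => bc; have := boundary_height bN; rewrite bc.
by have := height_c; lia.
Qed.

Let c_neq_down o o' : (down o c == c = false) * (down o (down o' c) == c = false)
  * (down o c == d = false) * (down o (down o' c) == d = false) * (c == d = false)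
  * (d == c = false).
Proof.
have ne u v : height u != height v -> u == v = false.
  by move=> h; apply/eqP => e; move: h; rewrite e eqxx.
by do !split; apply: ne; rewrite /d ?height_down3 ?height_down; lia.
Qed.

Let flip_longE o v : v != c -> flip_long x c long o v = long o v.
Proof. by rewrite /flip_long => /negbTE ->. Qed.

Let flip_long_c o : flip_long x c long o c = star_triangle x l o.
Proof. by rewrite /flip_long eqxx. Qed.

Let tile_neq_c o v : tile L o v -> v != c.
Proof. by case/andP => /L_neq_c. Qed.

(* The three lower faces impose on a coloring the constraints of the left-hand
   side of [star_triangleP], the three upper ones those of its right-hand side. *)
Let lower_faces (P : pred Z3) :
  (forall o, let v := down o c in
     P (end1 (long o v) o v) = P (end2 (long o v) o v)) <->
  (forall o, if l o then P (down (other1 (other2 o)) (down (other2 (other2 o)) c)) =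
                         P (down (other1 (other1 o)) (down (other2 (other1 o)) c))
             else P (down o c) = P d).
Proof.
by split=> h o; have := h o; rewrite /end1 /end2 /= -/(l o); case: (l o); case: o.
Qed.

(** The flip brings in the vertex [c] and discards [d]. By [star_triangleP] it is enough to recolor
    [c] here, and [d] in the converse passage. *)
Lemma invariant_flip P : invariant L long P ->
  exists E, invariant (flip L c) (flip_long x c long) (recolor P c E).
Proof.
move=> iP.
have [h _] := star_triangleP x (fun o => P (down o c))
  (fun o => P (down (other1 o) (down (other2 o) c))) long_lower_faces.
case: h => [|E hE].
  by exists (P d); apply/lower_faces => o; apply: iP; apply: tile_down_c.
exists E => o v; rewrite tile_flip => /orP[/eqP ->|/andP[tv vd]].
  rewrite flip_long_c; have := hE o; rewrite /end1 /end2 /recolor.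
  by case: ifP => _; rewrite ?eqxx !c_neq_down.
rewrite flip_longE ?(tile_neq_c tv) // /recolor.
have [e1 e2] := ends_L (long o v) o (proj1 (andP tv)).
by rewrite !(negbTE (L_neq_c _)) //; apply: iP.
Qed.

Lemma invariant_unflip P : invariant (flip L c) (flip_long x c long) P ->
  exists D, invariant L long (recolor P d D).
Proof.
move=> iP.
have [_ h] := star_triangleP x (fun o => P (down o c))
  (fun o => P (down (other1 o) (down (other2 o) c))) long_lower_faces.
case: h => [|D hD].
  exists (P c) => o; have := iP o c; rewrite tile_flip eqxx flip_long_c => /(_ isT).
  by case: ifP.
exists D => o v tv; have [->|vd] := eqVneq v (down o c).
  move: o {tv}; apply/lower_faces => o; have := hD o.
  by rewrite /recolor eqxx !c_neq_down.
have [e1 e2] := ends_neq_d (long o v) tv vd.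
rewrite /recolor (negbTE e1) (negbTE e2) -flip_longE ?(tile_neq_c tv) //.
by apply: iP; rewrite tile_flip tv vd orbT.
Qed.

Lemma pregrove_flip : pregrove N (flip L c) (flip_long x c long).
Proof.
split.
- by move=> v /orP[/eqP ->|/(pg_nonpos pg)].
- move=> o v /orP[/eqP ->|/(pg_down pg o) Lv]; rewrite /flip ?down_c ?orbT //.
  by rewrite Lv orbT.
- move=> v /orP[/eqP -> _ _|Lv]; first by have := height_c; lia.
  by rewrite negb_or => /andP[_]; apply: (pg_cutoff pg).
- move=> o v; rewrite tile_flip => /orP[/eqP ->|/andP[tv _]].
    by have := height_c; lia.
  by rewrite flip_longE ?(tile_neq_c tv) //; apply: (pg_far pg).
- move=> P v iP.
  (* A vertex other than [c] was present before the flip, and it is not [d], whose [up3] is now in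
     the ideal; so its color survives unflipping. *)
  have main w : flip L c w -> w != c -> ~~ flip L c (up3 w) -> P w ->
      exists2 b, boundary N b & P b.
    rewrite /flip negb_or => /orP[->//|Lw] wc /andP[nwc nLw] Pw.
    have [D iD] := invariant_unflip iP.
    have wd : w != d by apply: contraNneq nwc => ->; rewrite down3K.
    have [|b bN] := pg_reach pg iD Lw nLw; first by rewrite /recolor (negbTE wd).
    by rewrite /recolor (negbTE (boundary_neq_d bN)); exists b.
  move=> Lv nLv Pv; have [vc|vc] := eqVneq v c; last exact: main vc nLv Pv.
  (* The new vertex [c] shares its color with an old one across a short upper face. *)
  have [o short] := star_triangle_short x l.
  apply: (main (down (other1 o) (down (other2 o) c))).
  + by rewrite /flip (pg_down pg) ?orbT.
  + by rewrite c_neq_down.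
  + rewrite /flip.
    have -> : up3 (down (other1 o) (down (other2 o) c)) = up o c.
      by case: (o); rewrite /up3 /= ?subrK.
    by have := tile_flip o c; rewrite eqxx /= => /andP[].
  + have := iP o c; rewrite tile_flip eqxx flip_long_c (negbTE short) /= => <- //.
    by rewrite -vc.
- move=> b b' bN b'N dif; have [P [iP Pb Pb']] := pg_separate pg bN b'N dif.
  have [E iE] := invariant_flip iP; exists (recolor P c E).
  by rewrite /recolor !(negbTE (boundary_neq_c _)).
Qed.

End Flip.

(** * Counting long edges by induction on the upper set *)

Lemma exists_lowest (s : seq Z3) : s != [::] ->
  exists2 c, c \in s & forall v, v \in s -> height c <= height v.
Proof.
elim: s => // a s IH _; have [->|/IH[c cs hc]] := eqVneq s [::].
  by exists a => [|v]; rewrite inE // => /eqP ->.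
have [ac|ca] := lerP (height a) (height c).
  exists a; rewrite ?mem_head // => v; rewrite inE => /orP[/eqP ->//|/hc].
  exact: le_trans.
exists c; rewrite ?inE ?cs ?orbT // => v; rewrite inE => /orP[/eqP ->|/hc //].
exact: ltW.
Qed.

(** The orientation [x] is fixed during the whole induction, so that every free choice in a flip
    favors the same inequality. Different [x] may lead to different sequences of pregroves, but all
    start from the same counts. *)
Lemma pregrove_long_count N x (u : seq Z3) L long (s : orientation -> seq Z3) :
  pregrove N L long -> (forall v, (v \in u) = nonpos v && ~~ L v) ->
  (forall o, uniq (s o)) ->
  (forall o v, (v \in s o) = tile L o v && long o v) ->
  (size (s x) <= size (s (other1 x)) + size (s (other2 x)))%N /\
  ~~ odd (size (s x) + size (s (other1 x)) + size (s (other2 x))).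
Proof.
have [m] := ubnP (size u).
elim: m u L long s => // m IH u L long s um pg uE s_uniq sE.
have [u0|/exists_lowest[c cu c_low]] := eqVneq u [::].
  have LE v : L v = nonpos v.
    apply/idP/idP => [/(pg_nonpos pg)//|nv]; apply: contraTT isT => nL.
    by have := uE v; rewrite u0 nv nL.
  have s0 o : s o = [::].
    case es: (s o) => [//|v s']; have := sE o v; rewrite es mem_head.
    move=> /esym/andP[tv lv].
    by have := base_no_long pg LE tv; rewrite lv.
  by rewrite !s0.
have := uE c; rewrite cu => /esym/andP[c_nonpos cL].
(* A point below [c] outside [L] would be a lower element of [u]. *)
have down_c o : L (down o c).
  apply: contraT => nL; have : down o c \in u.
    by rewrite uE nL andbT; move: c_nonpos; rewrite /nonpos; case: (o) => /=; lia.
  by move/c_low; rewrite height_down; lia.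
have not3 := long_lower_faces pg cL c_nonpos down_c.
have := pregrove_flip pg cL c_nonpos down_c x.
set l := fun o => long o (down o c).
set l' := star_triangle x l => pg'.
(* The lower face at [down o c] disappears and the upper face at [c] is counted if it is long. *)
pose s' o := nseq (l' o) c ++ [seq v <- s o | v != down o c].
have c_notin o : c \notin s o by rewrite sE /tile (negbTE cL).
have s'_size o : (size (s' o) + l o = size (s o) + l' o)%N.
  have := count_predC (pred1 (down o c)) (s o).
  rewrite count_uniq_mem // sE (tile_down_c cL down_c) size_cat size_nseq.
  by rewrite size_filter /l /= => <-; rewrite addnAC -addnA addnC.
have [] := IH ([seq v <- u | v != c]) _ _ s' _ pg'.
- rewrite -ltnS (leq_trans _ um) // ltnS size_filter -(count_predC (pred1 c) u).
  by rewrite -[X in (X < _)%N]add0n ltn_add2r -has_count has_pred1.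
- move=> v; rewrite mem_filter uE /flip /= negb_or.
  by rewrite andbCA.
- move=> o; rewrite cat_uniq filter_uniq // andbT; apply/andP; split.
    by case: (l' o).
  apply/hasPn => v; rewrite mem_filter => /andP[_ vs].
  by rewrite mem_nseq negb_and; apply/orP; right; apply: contraNneq (c_notin o) => <-.
- move=> o v; rewrite mem_cat mem_nseq mem_filter sE (tile_flip pg cL down_c).
  rewrite /flip_long /=; have [->|vc] /= := eqVneq v c.
    rewrite -/l -/l' andbT lt0b /tile (negbTE cL) /= andbF orbF //.
  by rewrite andbF andbCA andbA.
have [] := star_triangle_count x (l := l) not3; rewrite -/l'.
have := s'_size x; have := s'_size (other1 x); have := s'_size (other2 x).
move: (size (s' x)) (size (s' (other1 x))) (size (s' (other2 x))).
move: (l x : nat) (l' x : nat) (l (other1 x) : nat) (l' (other1 x) : nat)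
  (l (other2 x) : nat) (l' (other2 x) : nat) => *; lia.
Qed.

(** * From groves to pregroves *)

Lemma card_eq_seq (T : eqType) (A : set T) n : A #= `I_n ->
  exists s : seq T, [/\ uniq s, size s = n & forall x, A x <-> x \in s].
Proof.
move=> An; have /finite_seqP[s As] : finite_set A by apply/finite_setP; exists n.
have Aus : A = [set` undup s] by rewrite As; apply/seteqP; split=> x; rewrite /= mem_undup.
exists (undup s); split; rewrite ?undup_uniq //; last by rewrite Aus.
apply/card_eq_II; apply: card_eq_trans An; rewrite Aus card_eq_sym.
case us: (undup s) => [|x0 s']; first by rewrite II0 set_nil.
have -> : [set` x0 :: s'] = nth x0 (x0 :: s') @` `I_(size (x0 :: s')).
  apply/seteqP; split=> [x /= /(nthP x0)[i]|_ [i /= ni <-]]; first by exists i.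
  exact: mem_nth.
apply: inj_card_eq => i j; rewrite !inE => ni nj /eqP.
by rewrite nth_uniq // -?us ?undup_uniq // => /eqP.
Qed.

Lemma long_edgeE o v : long_edge o v.1.1 v.1.2 v.2 =
  [set end1 true o v; end2 true o v].
Proof. by case: o. Qed.

Lemma short_edgeE o v : short_edge o v.1.1 v.1.2 v.2 =
  [set end1 false o v; end2 false o v].
Proof. by case: o; case: v => -[]. Qed.

(** The top vertex [v] lies on the short edge, while both ends of the long edge have height
    [height v - 1]. *)
Lemma long_neq_short o v :
  long_edge o v.1.1 v.1.2 v.2 <> short_edge o v.1.1 v.1.2 v.2.
Proof.
rewrite long_edgeE short_edgeE => e.
have : [set end1 true o v; end2 true o v] v by rewrite e; left.
by case=> /(congr1 height); rewrite /= height_down; lia.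
Qed.

(** Long edges of one orientation can thus be counted by the top vertices of their rhombi. *)
Lemma long_edge_inj o : injective (fun v : Z3 => long_edge o v.1.1 v.1.2 v.2).
Proof.
move=> u v /=; rewrite !long_edgeE => e.
have h1 : [set end1 true o v; end2 true o v] (end1 true o u) by rewrite -e; left.
have h2 : [set end1 true o v; end2 true o v] (end2 true o u) by rewrite -e; right.
case: h1 h2 => [/(congr1 (up (other1 o)))|h1 [h2|/(congr1 (up (other2 o)))]];
  rewrite /= ?upK //.
move: h1 h2 => /(congr1 (coord (other1 o))) h1 /(congr1 (coord (other1 o))).
by case: o h1 {e} => /=; lia.
Qed.

Lemma rhombus_inE (L : set Z3) o v : order_ideal L ->
  rhombus_in (initial L) o v.1.1 v.1.2 v.2 <-> tile (fun v => `[< L v >]) o v.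
Proof.
move=> ideal; have {}ideal u w : L u ->
    [/\ w.1.1 <= u.1.1, w.1.2 <= u.1.2 & w.2 <= u.2] -> L w.
  by case: u => -[i j] k /ideal h hw; apply: h.
rewrite /tile; split=> [h|/andP[/asboolP Lv /asboolP nLv]].
- apply/andP; split; apply/asboolP.
    by have [|] := h v; [case: (o); case: (v) => -[i j] k; do 3 left|].
  have [|_ ] := h (down (other1 o) (down (other2 o) v)); first by case: (o); right.
  by case: (o); rewrite /= ?subrK.
- have nL w : [/\ (up o v).1.1 <= w.1.1, (up o v).1.2 <= w.1.2 & (up o v).2 <= w.2] ->
      ~ L w by move=> le_w Lw; apply/nLv/(ideal _ _ Lw).
  by case: o nL {nLv} => /= nL w [[[]|]|] ->; split; rewrite /=;
    try (apply: (ideal _ _ Lv); split=> /=; lia); apply: nL; split=> /=; lia.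
Qed.

Definition below (L : set Z3) : pred Z3 := fun v => `[< L v >].

Definition long_in (G : graph Z3) (o : orientation) : pred Z3 :=
  fun v => `[< edges G (long_edge o v.1.1 v.1.2 v.2) >].

Lemma long_inP N L G o v : order_ideal L -> grove (initial L) N G ->
  tile (below L) o v ->
  reflect (~ edges G (short_edge o v.1.1 v.1.2 v.2)) (long_in G o v).
Proof.
move=> ideal grv /(rhombus_inE _ _ ideal)/(grove_rhombus grv) rh.
apply: (iffP (asboolP _)); case: rh => e [[[->|->] Ge] uniq_e] //.
- move=> _ Gs; apply: (@long_neq_short o v); apply: uniq_e; split=> //; by right.
- by move=> Gl _; apply: (@long_neq_short o v); apply/esym/uniq_e; split=> //; left.
Qed.

Lemma tile_edge N L G o v : order_ideal L -> grove (initial L) N G ->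
  tile (below L) o v ->
  adjacent G (end1 (long_in G o v) o v) (end2 (long_in G o v) o v).
Proof.
move=> ideal grv tv; rewrite /adjacent.
have [/asboolP|nl] := boolP (long_in G o v); first by rewrite long_edgeE.
rewrite -short_edgeE; apply: contrapT => ns; move/negP: nl; apply.
exact/(long_inP ideal grv tv).
Qed.

Lemma adjacent_sym G (u v : Z3) : adjacent G u v -> adjacent G v u.
Proof. by rewrite /adjacent setUC. Qed.

Lemma connected_sym G (u v : Z3) :
  clos_refl_trans Z3 (adjacent G) u v -> clos_refl_trans Z3 (adjacent G) v u.
Proof.
elim=> [a b /adjacent_sym ab|a|a b c _ ba _ cb]; [exact: rt_step|exact: rt_refl|].
exact: rt_trans cb ba.
Qed.

Lemma invariant_connected N L G P u v : order_ideal L -> grove (initial L) N G ->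
  invariant (below L) (long_in G) P ->
  clos_refl_trans Z3 (adjacent G) u v -> P u = P v.
Proof.
move=> ideal grv iP; elim=> [a b Gab|//|a b c _ -> _ -> //].
have [_ /(_ _ Gab)[o [i [j [k [rin eab]]]]] _] := grove_subgraph grv.
have tv := proj1 (rhombus_inE o (i, j, k) ideal) rin.
have Pv := iP _ _ tv.
suff [x [y [eP exy]]] : exists x y, P x = P y /\ [set a; b] = [set x; y].
  have : [set x; y] a by rewrite -exy; left.
  have : [set x; y] b by rewrite -exy; right.
  by case=> ->; case=> ->.
exists (end1 (long_in G o (i, j, k)) o (i, j, k)).
exists (end2 (long_in G o (i, j, k)) o (i, j, k)); split=> //.
case: eab => eab.
- have -> : long_in G o (i, j, k) by apply/asboolP; rewrite /= -eab.
  by rewrite -long_edgeE.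
- have /negbTE -> : ~~ long_in G o (i, j, k).
    by apply/negP => /(long_inP ideal grv tv); apply; rewrite /= -eab.
  by rewrite -short_edgeE.
Qed.

Lemma grove_pregrove L N G : order_ideal L -> L `<=` C 0 0 0 ->
  cutoff (initial L) N -> grove (initial L) N G ->
  pregrove N (below L) (long_in G).
Proof.
move=> ideal sub [_ cut] grv; split.
- by move=> v /asboolP/sub[*]; apply/and3P.
- move=> o [[i j] k] /asboolP/ideal Lv; apply/asboolP/Lv.
  by case: o; split=> /=; lia.
- move=> v /asboolP Lv /asboolP nLv np; rewrite ltNge; apply/negP => hv.
  have Iv : initial L v by split.
  case: v np hv Iv {Lv nLv} => -[i j] k np hv; apply: cut => //.
  by move: np; rewrite /nonpos /= !gt_max; lia.
- move=> o v tv hv; apply/negP => /(long_inP ideal grv tv); apply.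
  apply: (grove_far grv); first exact/rhombus_inE.
  by move: v hv {tv} => -[[i j] k] hv w;
    case: o => -[[[]|]|] -> /=; move: hv; rewrite /height /=; lia.
- move=> P v iP /asboolP Lv /asboolP nLv Pv.
  have Kv : components G (component_of G v).
    by exists v => //; rewrite (grove_vertices grv).
  have [S [[bS SK] _]] := grove_component grv Kv.
  have [b Sb] : S !=set0.
    by case: bS => [[p [q [_ _ _ [] ->]]]|[p [_ ->]]|[q [_ [] ->]]];
      eexists; by [left|left; left|].
  exists b; first by exists S.
  have [_ vb] := SK _ Sb.
  by rewrite -(invariant_connected ideal grv iP vb).
- move=> b b' [S bS Sb] [S' bS' S'b'] dif.
  (* The separating coloring is the indicator of the component of [b]. If it contained [b'], it
     would contain the boundary sets of both, which the uniqueness in [grove_component]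
     identifies. *)
  pose P u := `[< clos_refl_trans Z3 (adjacent G) b u >].
  exists P; split.
  + move=> o v tv; have e := tile_edge ideal grv tv; apply/asboolP/asboolP => h.
      by apply: rt_trans h (rt_step _ _ _ _ e).
    by apply: rt_trans h (rt_step _ _ _ _ (adjacent_sym e)).
  + by apply/asboolP; apply: rt_refl.
  + apply/asboolP => bb'.
    have in_comp T t : boundary_sets N T -> T t ->
        clos_refl_trans Z3 (adjacent G) b t -> T `<=` component_of G b.
      move=> bT Tt bt s Ts; have [K [v0 _ <-] TK] := grove_boundary grv bT.
      have [_ v0t] := TK _ Tt; have [Vs v0s] := TK _ Ts; split=> //.
      by apply: rt_trans bt _; apply: rt_trans (connected_sym v0t) v0s.
    have Kb : components G (component_of G b).
      exists b => //; have [K [v0 _ <-] SK] := grove_boundary grv bS.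
      by have [] := SK _ Sb.
    have [S0 [_ S0_uniq]] := grove_component grv Kb.
    have e1 : S0 = S by apply: S0_uniq; split=> //; apply: in_comp Sb (rt_refl _ _ _).
    have e2 : S0 = S' by apply: S0_uniq; split=> //; apply: in_comp S'b' bb'.
    by apply: dif bS Sb _; rewrite -e1 e2.
Qed.

Lemma long_edges_seq L G o n : order_ideal L ->
  long_edges (initial L) G o #= `I_n ->
  exists s : seq Z3, [/\ uniq s, size s = n &
    forall v, (v \in s) = tile (below L) o v && long_in G o v].
Proof.
move=> ideal card_n.
pose T := [set v | tile (below L) o v && long_in G o v].
pose f (v : Z3) := long_edge o v.1.1 v.1.2 v.2.
have fT : long_edges (initial L) G o = f @` T.
  apply/seteqP; split=> [e [Ge [i [j [k [rin eE]]]]]|_ [v /andP[tv /asboolP lv] <-]].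
    exists (i, j, k) => //; apply/andP; split; first exact/(rhombus_inE _ _ ideal).
    by apply/asboolP; rewrite -eE.
  by split=> //; exists v.1.1, v.1.2, v.2; split=> //; apply/rhombus_inE.
have cT : T #= `I_n.
  apply: card_eq_trans card_n; rewrite fT card_eq_sym; apply: inj_card_eq.
  by move=> u v _ _; apply: long_edge_inj.
have [s [us ss sE]] := card_eq_seq cT.
by exists s; split=> // v; apply/idP/idP => /sE.
Qed.

Theorem theorem4 (L : set Z3) (N : int) (G : graph Z3) (n_a n_b n_c : nat)
  (L_ideal : order_ideal L)
  (L_sub : L `<=` C 0 0 0)
  (U_fin : finite_set (upper L `&` C 0 0 0))
  (N_cutoff : cutoff (initial L) N)
  (G_grove : grove (initial L) N G)
  (card_a : long_edges (initial L) G Oa #= `I_n_a)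
  (card_b : long_edges (initial L) G Ob #= `I_n_b)
  (card_c : long_edges (initial L) G Oc #= `I_n_c) :
  [/\ 0 <= n_a%:Z + n_b%:Z - n_c%:Z /\ (2 %| n_a%:Z + n_b%:Z - n_c%:Z)%Z,
      0 <= n_b%:Z + n_c%:Z - n_a%:Z /\ (2 %| n_b%:Z + n_c%:Z - n_a%:Z)%Z &
      0 <= n_c%:Z + n_a%:Z - n_b%:Z /\ (2 %| n_c%:Z + n_a%:Z - n_b%:Z)%Z].
Proof.
have [s_a [uniq_a <- memE_a]] := long_edges_seq L_ideal card_a.
have [s_b [uniq_b <- memE_b]] := long_edges_seq L_ideal card_b.
have [s_c [uniq_c <- memE_c]] := long_edges_seq L_ideal card_c.
pose s o := match o with Oa => s_a | Ob => s_b | Oc => s_c end.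
have [u uE] := iffLR (finite_seqP _) U_fin.
have memE_u v : (v \in u) = nonpos v && ~~ below L v.
  have memE : v \in u <-> (upper L `&` C 0 0 0) v by rewrite uE.
  apply/idP/andP => [/memE[nLv [v1 v2 v3]]|[/and3P[v1 v2 v3] /asboolP nLv]].
    by split; [apply/and3P|apply/asboolP].
  by apply/memE; split=> //; split.
have count x := @pregrove_long_count N x u _ _ s
  (grove_pregrove L_ideal L_sub N_cutoff G_grove) memE_u.
have {}count x : (size (s x) <= size (s (other1 x)) + size (s (other2 x)))%N /\
  ~~ odd (size (s x) + size (s (other1 x)) + size (s (other2 x))).
  by apply: count => -[].
(* The three inequalities give nonnegativity. Each quantity differs from the total count by twice
   one of the counts, so evenness of the total settles parity. *)
move: (count Oa) (count Ob) (count Oc) => /= [a1 a2] [b1 b2] [c1 c2].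
by split; split; lia.
Qed.
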